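(* The following hold: (i) $\mathrm{ex}_\circlearrowright(n,M_3)=\binom n3-\binom{n-3}{3}$ for all $n\ge 3$; (ii) $\mathrm{ex}_\circlearrowright(n,M_2)=\binom n2-2$ for all $n\ge 7$; (iii) $\mathrm{ex}_\circlearrowright(n,S_3)=\frac{n(n-2)}{2}$ for all even $n\ge 4$.
   Context: $\Omega_n=\{v_0,\dots,v_{n-1}\}$ is the vertex set of a regular $n$-gon with the clockwise cyclic ordering. We write $x_1<x_2<\dots<x_k<x_1$ to mean that $x_1,\dots,x_k$ are distinct and occur in this clockwise cyclic order. A convex geometric hypergraph (cgh) on $\Omega_n$ is a set $H$ of $3$-element subsets (edges) of $\Omega_n$. A cgh $H$ contains a cgh $F$ if there is an injection from the vertex set of $F$ to the vertex set of $H$ preserving the cyclic ordering and mapping edges to edges; otherwise $H$ is $F$-free. $\mathrm{ex}_\circlearrowright(n,F)$ is the maximum number of edges in an $F$-free cgh on $\Omega_n$. The configurations are the following cghs with two edges: - $M_3$: $\{x_1,x_3,x_5\},\{x_2,x_4,x_6\}$ with $x_1<x_2<\dots<x_6<x_1$. - $M_2$: $\{x_1,x_2,x_4\},\{x_3,x_5,x_6\}$ with $x_1<x_2<\dots<x_6<x_1$. - $S_3$: $\{x_1,x_2,x_4\},\{x_1,x_3,x_5\}$ with $x_1<x_2<\dots<x_5<x_1$. *)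

(* Defs.v *)
From mathcomp Require Import all_boot.

Set Implicit Arguments.
Unset Strict Implicit.
Unset Printing Implicit Defensive.

(* The vertex v_i of the regular n-gon is i : 'I_n, numbered clockwise;
   cyc_lt x y z is x < y < z < x in the cyclic order (so x, y, z are distinct). *)
Definition cyc_lt (n : nat) (x y z : 'I_n) : bool :=
  [|| x < y < z, y < z < x | z < x < y].

Definition is_cgh (n : nat) (H : {set {set 'I_n}}) : bool :=
  [forall e in H, #|e| == 3].

Definition preserves_cyc (m n : nat) (f : 'I_m -> 'I_n) : bool :=
  [forall x, forall y, forall z,
     cyc_lt x y z ==> cyc_lt (f x) (f y) (f z)].

(* All of 'I_m is the vertex set of the pattern F: isolated vertices of F, if
   any, are embedded too. *)
Definition contains (m n : nat) (F : {set {set 'I_m}}) (H : {set {set 'I_n}})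
    : bool :=
  [exists f : {ffun 'I_m -> 'I_n},
     [&& injectiveb f, preserves_cyc f & [forall e in F, f @: e \in H]]].

Definition ex_cyc (n m : nat) (F : {set {set 'I_m}}) : nat :=
  \max_(H : {set {set 'I_n}} | is_cgh H && ~~ contains F H) #|H|.

(* In the patterns below x_i is the ordinal i - 1. *)
Definition M3 : {set {set 'I_6}} :=
  [set [set inord 0; inord 2; inord 4]; [set inord 1; inord 3; inord 5]].

Definition M2 : {set {set 'I_6}} :=
  [set [set inord 0; inord 1; inord 3]; [set inord 2; inord 4; inord 5]].

Definition S3 : {set {set 'I_5}} :=
  [set [set inord 0; inord 1; inord 3]; [set inord 0; inord 2; inord 4]].

(* Main.v *)
(* Read a cgh on n points as a symmetric n-periodic predicate h on nat, so that
   cyclic configurations become increasing sequences x_1 < ... < x_k < x_1 + n.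

   M3: merge the last two points n-2 and n-1.  The triples lost are those through
   both points, and one for each pair {a, b} joined to both; M3-freeness makes
   the graph of these pairs noncrossing, so it has at most 2(n-2) - 3 edges, and
   induction on n gives the bound.  It is attained by the triples that contain 0
   or two cyclically adjacent points.

   S3: the link of every vertex is a noncrossing graph on n-1 points in convex
   position, hence has at most n-4 diagonals.  A triple that is not of the form
   {i, i+1, i+2} gives a diagonal in the link of at least two of its vertices, so
   2|H| <= n(n-4) + 2n.  For even n this is attained by the triples that contain
   an edge of the perfect matching {2k, 2k+1}.

   M2: induction on n from n = 7, merging a suitable adjacent pair {i, i+1}, which
   must cost at most n-1 triples.  The pairs joined to both i and i+1 form an
   intersecting graph on n-2 points: at most n-4 edges, or a full star with n-3.
   Call a triple {i, i+1, a} with a distinct from i-1 and i+2 a chord at i.  A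
   shortest chord shows that some i has at most one chord, and a full star yields
   a pair without any chord; either way the cost is at most n-1.  The bound is
   attained by the triples containing 0 together with the triples {i, i+1, i+2}. *)
Require Import Defs.
From mathcomp Require Import all_boot zmodp zify.

Set Implicit Arguments.
Unset Strict Implicit.
Unset Printing Implicit Defensive.

(** * Counting pairs and triples of naturals *)

Definition pairs (e : nat -> nat -> nat) (n : nat) : nat :=
  \sum_(y < n) \sum_(x < y) e x y.

Definition triples (f : nat -> nat -> nat -> nat) (n : nat) : nat :=
  \sum_(z < n) pairs (fun x y => f x y z) z.

Lemma pairsS e n : pairs e n.+1 = pairs e n + \sum_(x < n) e x n.
Proof. by rewrite /pairs big_ord_recr. Qed.

Lemma triplesS f n :
  triples f n.+1 = triples f n + pairs (fun x y => f x y n) n.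
Proof. by rewrite /triples big_ord_recr. Qed.

Lemma pairs0 e : pairs e 0 = 0.
Proof. by rewrite /pairs big_ord0. Qed.

Lemma triples0 f : triples f 0 = 0.
Proof. by rewrite /triples big_ord0. Qed.

Lemma leq_pairs e e' n :
  (forall x y, x < y < n -> e x y <= e' x y) -> pairs e n <= pairs e' n.
Proof.
move=> le_ee'; apply: leq_sum => y _; apply: leq_sum => x _.
by apply: le_ee'; rewrite !ltn_ord.
Qed.

Lemma eq_pairs e e' n :
  (forall x y, x < y < n -> e x y = e' x y) -> pairs e n = pairs e' n.
Proof.
by move=> ee'; apply/eqP; rewrite eqn_leq !leq_pairs // => x y /ee' ->.
Qed.

Lemma leq_triples f f' n :
  (forall x y z, x < y < z -> z < n -> f x y z <= f' x y z) ->
  triples f n <= triples f' n.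
Proof.
by move=> le_ff'; apply: leq_sum => z _; apply: leq_pairs => x y xy; apply: le_ff'.
Qed.

Lemma eq_triples f f' n :
  (forall x y z, x < y < z -> z < n -> f x y z = f' x y z) ->
  triples f n = triples f' n.
Proof.
by move=> ff'; apply/eqP; rewrite eqn_leq !leq_triples // => x y z /ff' h /h ->.
Qed.

Lemma pairsD e e' n :
  pairs (fun x y => e x y + e' x y) n = pairs e n + pairs e' n.
Proof. by rewrite /pairs -big_split; apply: eq_bigr => y _; rewrite big_split. Qed.

Lemma triplesD f f' n :
  triples (fun x y z => f x y z + f' x y z) n = triples f n + triples f' n.
Proof.
by rewrite /triples -big_split; apply: eq_bigr => z _; rewrite pairsD.
Qed.

Lemma triples_sum m (F : nat -> nat -> nat -> nat -> nat) n :
  \sum_(v < m) triples (F v) n = triples (fun x y z => \sum_(v < m) F v x y z) n.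
Proof.
elim: m => [|m IHm].
  rewrite big_ord0 /triples /pairs; apply/esym.
  by do 3![rewrite big1 // => ? _]; rewrite big_ord0.
rewrite big_ord_recr IHm /= -triplesD.
by apply: eq_triples => x y z _ _; rewrite big_ord_recr.
Qed.

Lemma pairs_recl e n :
  pairs e n.+1 = \sum_(y < n) e 0 y.+1 + pairs (fun x y => e x.+1 y.+1) n.
Proof.
elim: n => [|n IHn]; first by rewrite pairsS !pairs0 !big_ord0.
by rewrite pairsS IHn pairsS big_ord_recl [in RHS]big_ord_recr addnACA.
Qed.

Lemma triples_recl f n :
  triples f n.+1 = pairs (fun y z => f 0 y.+1 z.+1) n
                   + triples (fun x y z => f x.+1 y.+1 z.+1) n.
Proof.
elim: n => [|n IHn]; first by rewrite triplesS !triples0 !pairs0.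
by rewrite triplesS IHn triplesS pairs_recl pairsS addnACA.
Qed.

(** The two adjacent transpositions generate all permutations, so periodicity in the first argument
    carries over to the others. The codomain is generic to cover both predicates and their counting
    versions. *)
Definition cyclic_fun (T : Type) (n : nat) (f : nat -> nat -> nat -> T) : Prop :=
  [/\ forall x y z, f x y z = f y x z, forall x y z, f x y z = f x z y
    & forall x y z, f (x + n) y z = f x y z].

(** It suffices to shift by one: the last point of the shifted range is congruent to the first point
    of the old one, so its triples are those split off by [triples_recl]. *)
Lemma triples_rot f n s : cyclic_fun n f ->
  triples (fun x y z => f (x + s) (y + s) (z + s)) n = triples f n.
Proof.
move=> [fC fA fn]; elim: s => [|s IHs].
  by apply: eq_triples => x y z _ _; rewrite !addn0.
rewrite -{}IHs; case: n fn => [|n] fn; first by rewrite !triples0.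
rewrite triplesS [RHS]triples_recl addnC; congr (_ + _).
  apply: eq_pairs => x y _; rewrite fA fC.
  by rewrite -(fn (0 + s)) -!addSnnS; congr f; lia.
by apply: eq_triples => x y z _ _; rewrite !addSnnS.
Qed.

Lemma triples_ord f n :
  triples f n
  = \sum_(p : 'I_n * ('I_n * 'I_n) | p.2.2 < p.2.1 < p.1) f p.2.2 p.2.1 p.1.
Proof.
rewrite -(pair_big_dep xpredT (fun (z : 'I_n) (q : 'I_n * 'I_n) => q.2 < q.1 < z)
            (fun (z : 'I_n) (q : 'I_n * 'I_n) => f q.2 q.1 z)) /=.
apply: eq_bigr => z _; rewrite /pairs.
rewrite (big_ord_widen n (fun y => \sum_(x < y) f x y z)); last exact: ltnW.
transitivity (\sum_(y < n | y < z) \sum_(x < n | x < y) f x y z).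
  by apply: eq_bigr => y _; rewrite (big_ord_widen n (fun x => f x y z)) // ltnW.
rewrite (pair_big_dep (fun y : 'I_n => y < z) (fun y x : 'I_n => x < y)
            (fun y x : 'I_n => f x y z)) /=.
by apply: eq_bigl => q; rewrite andbC.
Qed.

Definition tri (n : nat) (H : {set {set 'I_n.+1}}) (x y z : nat) : bool :=
  [set inZp x; inZp y; inZp z] \in H.

Lemma tri_cyclic n (H : {set {set 'I_n.+1}}) : cyclic_fun n.+1 (tri H).
Proof.
split=> x y z; rewrite /tri.
- by rewrite [[set inZp x; inZp y]]setUC.
- by rewrite setUAC.
- by have -> : inZp (x + n.+1) = inZp x :> 'I_n.+1 by apply: val_inj; rewrite /= modnDr.
Qed.

Lemma set3_sorted_inj n (a b c a' b' c' : 'I_n) :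
  a < b < c -> a' < b' < c' -> [set a; b; c] = [set a'; b'; c'] ->
  [/\ a = a', b = b' & c = c'].
Proof.
move=> abc abc' /setP eqs.
move: (eqs a) (eqs b) (eqs c) (eqs a') (eqs b') (eqs c').
rewrite !inE -!val_eqE /= !eqxx ?orbT /=.
by move=> *; split; apply: val_inj => /=; lia.
Qed.

Lemma set3_sortedP n (T : {set 'I_n}) : #|T| = 3 ->
  exists a b c : 'I_n, a < b < c /\ T = [set a; b; c].
Proof.
rewrite cardE => cardT; have uniqT := enum_uniq T.
have TE t : (t \in T) = (t \in enum T) by rewrite mem_enum.
case: (enum T) cardT uniqT TE => [|x [|y [|z []]]] //= _.
rewrite !inE -!val_eqE /= => /and3P[neq1 neq2 _] TE.
have {}TE a b c : perm_eq [:: x; y; z] [:: a; b; c] -> T = [set a; b; c].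
  by move=> /perm_mem eqs; apply/setP => t; rewrite TE eqs !inE orbA.
have := ltngtP x y; have := ltngtP x z; have := ltngtP y z.
do 3![case=> ?]; try lia;
  [ exists x, y, z | exists y, x, z | exists y, z, x
  | exists x, z, y | exists z, x, y | exists z, y, x]; (split; first lia);
  by apply: TE; apply/permP => P /=; do 3!case: (P _).
Qed.

(** Sending an increasing triple to its underlying set is injective because a sorted listing is
    unique, and onto [H] because every edge has three elements. *)
Lemma card_cgh n (H : {set {set 'I_n.+1}}) :
  is_cgh H -> #|H| = triples (tri H) n.+1.
Proof.
move=> /forall_inP cghH; rewrite triples_ord.
pose D := [set p : 'I_n.+1 * ('I_n.+1 * 'I_n.+1) |
            (p.2.2 < p.2.1 < p.1) && tri H p.2.2 p.2.1 p.1].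
have inZpE (x : 'I_n.+1) : inZp x = x by apply: val_inj; rewrite /= modn_small.
transitivity #|D|; last first.
  by rewrite -sum1dep_card big_mkcondr; apply: eq_bigr => p _; case: (tri _ _ _ _).
pose S (p : 'I_n.+1 * ('I_n.+1 * 'I_n.+1)) := [set p.2.2; p.2.1; p.1].
have <- : S @: D = H.
  apply/setP => T; apply/imsetP/idP => [[p + ->]|TH].
    by rewrite inE /tri !inZpE => /andP[].
  have [a [b [c [abc TE]]]] := set3_sortedP (eqP (cghH T TH)).
  by exists (c, (b, a)); rewrite // inE /tri !inZpE /= abc -TE.
rewrite card_in_imset // => -[c [b a]] [c' [b' a']].
rewrite !inE /= => /andP[abc _] /andP[abc' _].
by move=> /(set3_sorted_inj abc abc')[-> -> ->].
Qed.

(** * From hypergraphs to predicates *)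

(** Inside a window of length [n] there is at most one wraparound, which turns cyclic order into
    linear arithmetic. *)
Lemma modn_window a b n : a <= b < a + n ->
  b %% n = if a %% n + (b - a) < n then a %% n + (b - a)
           else a %% n + (b - a) - n.
Proof.
move=> ab; have an : a %% n < n by rewrite ltn_mod; lia.
have -> : b %% n = (a %% n + (b - a)) %% n by rewrite modnDml subnKC; lia.
case: ltnP => h; first exact: modn_small.
by rewrite -{1}(subnK h) modnDr modn_small; lia.
Qed.

Lemma cyc_lt_inZp n a b c : a < b < c -> c < a + n.+1 ->
  cyc_lt (inZp a : 'I_n.+1) (inZp b) (inZp c).
Proof.
move=> abc ca; rewrite /cyc_lt /=.
have an : a %% n.+1 < n.+1 by rewrite ltn_mod.
rewrite (@modn_window a b n.+1) ?(@modn_window a c n.+1); try lia.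
by do 2!case: ifP; lia.
Qed.

Lemma contains_inZp m n (F : {set {set 'I_m}}) (H : {set {set 'I_n.+1}})
    (x : nat -> nat) :
  (forall i j, i < j < m -> x i < x j < x i + n.+1) ->
  (forall e, e \in F -> [set inZp (x i) | i : 'I_m in e] \in H) ->
  contains F H.
Proof.
move=> xP FH; apply/existsP; exists [ffun i : 'I_m => inZp (x i)].
have xm i j : i < j -> j < m -> x i < x j < x i + n.+1.
  by move=> ij jm; apply: xP; rewrite ij.
apply/and3P; split.
- apply/injectiveP => i j; rewrite !ffunE => /(congr1 val) /= eqx.
  apply: val_inj => /=; apply/eqP; apply: contraT; rewrite neq_ltn.
  have an k : x k %% n.+1 < n.+1 by rewrite ltn_mod.
  case/orP => ij.
    have xij := xm _ _ ij (ltn_ord j); move: eqx (an i).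
    by rewrite (@modn_window (x i) (x j)); [case: ifP; lia|lia].
  have xij := xm _ _ ij (ltn_ord i); move: eqx (an j).
  by rewrite (@modn_window (x j) (x i)); [case: ifP; lia|lia].
- apply/forallP => i; apply/forallP => j; apply/forallP => k.
  apply/implyP; rewrite !ffunE => /or3P[] ijk.
  + have := (xm i j, xm j k, xm i k); rewrite !ltn_ord => -[[A B] C].
    by apply: cyc_lt_inZp; lia.
  + have := (xm j k, xm k i, xm j i); rewrite !ltn_ord => -[[A B] C].
    suff: cyc_lt (inZp (x j) : 'I_n.+1) (inZp (x k)) (inZp (x i)).
      by rewrite /cyc_lt => /or3P[] ->; rewrite ?orbT.
    by apply: cyc_lt_inZp; lia.
  + have := (xm k i, xm i j, xm k j); rewrite !ltn_ord => -[[A B] C].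
    suff: cyc_lt (inZp (x k) : 'I_n.+1) (inZp (x i)) (inZp (x j)).
      by rewrite /cyc_lt => /or3P[] ->; rewrite ?orbT.
    by apply: cyc_lt_inZp; lia.
- apply/forall_inP => e /FH; congr (_ \in H).
  by apply: eq_imset => i; rewrite ffunE.
Qed.

Lemma contains_pairP m n (e1 e2 : {set 'I_m}) (H : {set {set 'I_n}}) :
  contains [set e1; e2] H ->
  exists2 f : 'I_m -> 'I_n,
    forall i j k : 'I_m, i < j < k -> cyc_lt (f i) (f j) (f k)
    & f @: e1 \in H /\ f @: e2 \in H.
Proof.
case/existsP => f /and3P[_ /forallP cycf /forall_inP fH]; exists f.
  move=> i j k ijk; move/(_ i)/forallP/(_ j)/forallP/(_ k)/implyP: cycf; apply.
  by rewrite /cyc_lt ijk.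
by split; apply: fH; rewrite !inE eqxx ?orbT.
Qed.

Lemma imset_set3 (aT rT : finType) (f : aT -> rT) a b c :
  f @: [set a; b; c] = [set f a; f b; f c].
Proof. by rewrite !imsetU !imset_set1. Qed.

Lemma ex_cycP m (F : {set {set 'I_m}}) n b :
  (forall H : {set {set 'I_n}}, is_cgh H -> ~~ contains F H -> #|H| <= b) ->
  (exists2 H : {set {set 'I_n}}, is_cgh H && ~~ contains F H & #|H| = b) ->
  ex_cyc n F = b.
Proof.
move=> ub [H HF Hb]; apply/eqP; rewrite eqn_leq; apply/andP; split.
  by apply/bigmax_leqP => G /andP[]; apply: ub.
by rewrite -Hb; apply: (@leq_bigmax_cond _ _ (fun H : {set {set 'I_n}} => #|H|)).
Qed.

Lemma contains_pairI n m (H : {set {set 'I_n.+1}}) (s : seq nat) i j k i' j' k' :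
  sorted ltn s -> last 0 s < head 0 s + n.+1 -> size s = m.+1 ->
  tri H (nth 0 s i) (nth 0 s j) (nth 0 s k) ->
  tri H (nth 0 s i') (nth 0 s j') (nth 0 s k') ->
  all (leq^~ m) [:: i; j; k; i'; j'; k'] ->
  contains [set [set inord i; inord j; inord k : 'I_m.+1];
                [set inord i'; inord j'; inord k']] H.
Proof.
move=> sorted_s; rewrite -nth_last -nth0 => window size_s T1 T2 /=.
rewrite andbT -!(ltnS _ m) => /and5P[lti ltj ltk lti' /andP[ltj' ltk']].
have mono a b : a < b -> b < m.+1 -> nth 0 s a < nth 0 s b.
  by move=> ab bm; rewrite (sorted_ltn_nth ltn_trans) ?inE //; lia.
have monoW a b : a <= b -> b < m.+1 -> nth 0 s a <= nth 0 s b.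
  by rewrite leq_eqVlt => /orP[/eqP->//|ab bm]; rewrite ltnW ?mono.
rewrite size_s /= in window.
apply: (@contains_inZp _ _ _ _ (nth 0 s)) => [a b /andP[ab bm]|e].
  by have := mono _ _ ab bm; have := monoW 0 a; have := monoW b m; lia.
by rewrite !inE => /orP[] /eqP ->; rewrite imset_set3 !inordK.
Qed.

(** Only the values of [h] at increasing triples are read, so the extremal examples can be given by
    formulas that presuppose [x < y < z]. *)
Definition cgh_of (n : nat) (h : nat -> rel nat) : {set {set 'I_n}} :=
  [set T | [exists a : 'I_n, exists b : 'I_n, exists c : 'I_n,
     [&& a < b < c, h a b c & T == [set a; b; c]]]].

Lemma in_cgh_of n (h : nat -> rel nat) (T : {set 'I_n}) :
  reflect (exists a b c : 'I_n, [/\ a < b < c, h a b c & T = [set a; b; c]])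
          (T \in cgh_of n h).
Proof.
rewrite inE; apply: (iffP existsP) => [[a /existsP[b /existsP[c]]]|].
  by case/and3P => abc habc /eqP->; exists a, b, c.
case=> a [b [c [abc habc ->]]]; exists a; apply/existsP; exists b.
by apply/existsP; exists c; rewrite abc habc /=.
Qed.

(** A cyclically ordered triple is sorted by one of three rotations. *)
Lemma set3_cgh_of n (h : nat -> rel nat) (a b c : 'I_n) : cyc_lt a b c ->
  [set a; b; c] \in cgh_of n h ->
  [|| (a < b < c) && h a b c, (b < c < a) && h b c a | (c < a < b) && h c a b].
Proof.
move=> /or3P abc /in_cgh_of[a' [b' [c' [abc' habc' eqs]]]].
case: abc => abc; rewrite abc.
- by have [-> -> ->] := set3_sorted_inj abc abc' eqs; rewrite habc'.
- rewrite setUAC [[set a; c]]setUC in eqs; rewrite setUAC [[set c; b]]setUC in eqs.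
  by have [-> -> ->] := set3_sorted_inj abc abc' eqs; rewrite habc' orbT.
- rewrite setUAC [[set a; c]]setUC in eqs.
  by have [-> -> ->] := set3_sorted_inj abc abc' eqs; rewrite habc' !orbT.
Qed.

Lemma cgh_of_cgh n h : is_cgh (cgh_of n h).
Proof.
apply/forall_inP => T /in_cgh_of[a [b [c [abc _ ->]]]].
rewrite setUC cardsU1 cards2 !inE -!val_eqE /=; lia.
Qed.

Lemma card_cgh_of n h : #|cgh_of n h| = triples h n.
Proof.
case: n => [|n].
  rewrite triples0; apply/eqP; rewrite cards_eq0; apply/set0Pn => -[T].
  by case/in_cgh_of => -[].
rewrite card_cgh ?cgh_of_cgh //; apply: eq_triples => x y z xyz zn; congr nat_of_bool.
have val3 : [/\ (inZp x : 'I_n.+1) = x :> nat, (inZp y : 'I_n.+1) = y :> nat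
              & (inZp z : 'I_n.+1) = z :> nat].
  by split; rewrite /= modn_small; lia.
have [xE yE zE] := val3; apply/in_cgh_of/idP => [[a [b [c [abc]]]]|hxyz].
  move=> habc /set3_sorted_inj[|//|aE bE cE]; first by rewrite xE yE zE.
  by rewrite -xE -yE -zE aE bE cE.
by exists (inZp x), (inZp y), (inZp z); rewrite xE yE zE.
Qed.

Lemma ex_cyc_eq m n (F : {set {set 'I_m}}) b h :
  (forall H : {set {set 'I_n}}, is_cgh H -> ~~ contains F H -> #|H| <= b) ->
  ~~ contains F (cgh_of n h) -> triples h n = b -> ex_cyc n F = b.
Proof.
move=> ub nF hb; apply: ex_cycP => //; exists (cgh_of n h).
  by rewrite cgh_of_cgh.
by rewrite card_cgh_of.
Qed.

(** * The configuration M3 *)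

Lemma sum_bool_leq (p : nat -> bool) m : \sum_(x < m) p x <= m.
Proof.
by rewrite -[leqRHS]card_ord -sum1_card; apply: leq_sum => x _; apply: leq_b1.
Qed.

Lemma sum_bool_leq1 (p : nat -> bool) m :
  (forall x y, x < y < m -> ~~ (p x && p y)) -> \sum_(x < m) p x <= 1.
Proof.
elim: m => [|m IHm] pP; first by rewrite big_ord0.
rewrite big_ord_recr /=; case pm: (p m) => /=; last first.
  by rewrite addn0; apply: IHm => x y xy; apply: pP; lia.
rewrite big1 // => x _; have := pP x m; rewrite pm ltn_ord ltnSn !andbT.
by move=> /(_ isT) /negbTE ->.
Qed.

(* Merge the last two points: at most one common neighbour, and one edge, is lost. *)
Lemma noncrossing_pairs (e : rel nat) m : 2 <= m ->
  (forall a b c d, a < b < c -> c < d < m -> ~~ (e a c && e b d)) ->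
  pairs e m <= m.*2 - 3.
Proof.
elim: m e => [|[|m] IHm] //= e; case: m IHm => [|m] IHm _ ncr.
  by rewrite !pairsS pairs0 !big_ord_recr !big_ord0 /=; case: (e 0 1).
pose e' x y := e x y || (y == m.+1) && e x m.+2.
have {}IHm : pairs e' m.+2 <= m.+2.*2 - 3.
  apply: IHm => // a b c d abc cd; rewrite /e'.
  have := ncr a b c d; have := ncr a b c m.+2.
  by case: (d =P m.+1) => [->|_]; case: (c =P m.+1) => [?|_]; lia.
(* For two common neighbours [x < y], the edges [{x, m+1}] and [{y, m+2}] would cross. *)
have deg : \sum_(x < m.+1) (e x m.+1 && e x m.+2) <= 1.
  apply: (@sum_bool_leq1 (fun x => e x m.+1 && e x m.+2)) => x y xy.
  by have := ncr x y m.+1 m.+2; lia.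
have mergeE : pairs e m.+3 =
    pairs e' m.+2 + \sum_(x < m.+1) (e x m.+1 && e x m.+2) + e m.+1 m.+2.
  rewrite (pairsS _ m.+2) (pairsS _ m.+1) (pairsS _ m.+1).
  rewrite [\sum_(x < m.+2) _]big_ord_recr /=.
  have -> : pairs e m.+1 = pairs e' m.+1.
    by apply: eq_pairs => x y xy; rewrite /e'; case: eqP => [?|]; [lia|rewrite orbF].
  have : \sum_(x < m.+1) e x m.+1 + \sum_(x < m.+1) e x m.+2 =
     \sum_(x < m.+1) e' x m.+1 + \sum_(x < m.+1) (e x m.+1 && e x m.+2).
    rewrite -!big_split; apply: eq_bigr => x _.
    by rewrite /e' eqxx /=; do 2!case: (e _ _).
  by rewrite !addnA -(addnA (pairs _ _)) => ->; rewrite !addnA.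
by rewrite mergeE; case: (e m.+1 m.+2); lia.
Qed.

(** Merging replaces two truth values by their disjunction, so each pair joined to both points costs
    one triple; the triples through both points disappear altogether. *)
Lemma triples_merge (h h' : nat -> rel nat) m :
  (forall x y z, x < y < z -> z < m -> h' x y z = h x y z) ->
  (forall x y, x < y < m -> h' x y m = h x y m || h x y m.+1) ->
  triples h m.+2 = triples h' m.+1
    + pairs (fun x y => h x y m && h x y m.+1) m + \sum_(x < m) h x m m.+1.
Proof.
move=> h'E h'm; rewrite !triplesS pairsS !addnA; congr (_ + _).
rewrite -!addnA -!pairsD; congr (_ + _).
  by apply: eq_triples => x y z xyz zm; rewrite h'E.
by apply: eq_pairs => x y xy; rewrite h'm //; do 2!case: (h _ _ _).
Qed.

(** Rotating the alternating pattern only swaps its two triples, so every copy is an increasing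
    sequence below [n]. Passing from [m+3] to [m+4] points costs at most
    [(2(m+2) - 3) + (m+2) = 3m+3], exactly the growth of the bound. *)
Lemma triples_M3_free (h : nat -> rel nat) n : 3 <= n ->
  (forall a b c d e f, a < b < c -> c < d < e -> e < f < n ->
     ~~ (h a c e && h b d f)) ->
  triples h n <= 'C(n, 3) - 'C(n - 3, 3).
Proof.
elim: n h => [|[|[|m] IHm]] // h _ hfree; case: m IHm hfree => [|m] IHm hfree.
  rewrite !(triplesS, pairsS, triples0, pairs0, big_ord_recr, big_ord0) /=.
  by case: (h 0 1 2).
pose h' x y z := h x y z || (z == m.+2) && h x y m.+3.
rewrite (@triples_merge h h') /=; last 2 first.
- by move=> x y z xyz zm; rewrite /h'; case: eqP => [?|]; [lia|rewrite orbF].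
- by move=> x y xy; rewrite /h' eqxx.
(* Only the largest vertex [f] can be the merged point; reading it as [m+2] or as [m+3] leaves the
   order intact. *)
have {}IHm : triples h' m.+3 <= 'C(m.+3, 3) - 'C(m.+3 - 3, 3).
  apply: IHm => // a b c d e f abc cde ef; rewrite /h'.
  have := hfree a b c d e f; have := hfree a b c d e m.+3.
  by case: (f =P m.+2) => [->|_]; case: (e =P m.+2) => [?|_]; lia.
have ncr : pairs (fun x y => h x y m.+2 && h x y m.+3) m.+2 <= m.+2.*2 - 3.
  apply: (@noncrossing_pairs (fun x y => h x y m.+2 && h x y m.+3)) => //.
  by move=> a b c d abc cd; have := hfree a b c d m.+2 m.+3; lia.
have -> : m.+4 - 3 = m.+1 by lia.
rewrite (_ : m.+3 - 3 = m) in IHm; last by lia.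
have [C1 C2 C3] : [/\ 'C(m.+4, 3) = 'C(m.+3, 3) + 'C(m.+3, 2),
   'C(m.+1, 3) = 'C(m, 3) + 'C(m, 2) & 'C(m.+3, 2) = 'C(m, 2) + (m + m.+1 + m.+2)].
  by rewrite !(binS _ 2) !(binS _ 1) !bin1; split; lia.
have C4 : 'C(m, 3) <= 'C(m.+3, 3) by rewrite leq_bin2l // !leqW.
have := leq_add (leq_add IHm ncr) (sum_bool_leq (fun x => h x m.+2 m.+3) m.+2).
by move/leq_trans; apply; lia.
Qed.

Lemma sum_eqn k m : \sum_(x < m) (x == k :> nat) = (k < m).
Proof.
elim: m => [|m IHm]; first by rewrite big_ord0.
by rewrite big_ord_recr /= IHm; lia.
Qed.

(** The adjacency of the last point and 0 is covered by [x == 0]. *)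
Definition star_adjacent (x y z : nat) : bool :=
  [|| x == 0, y == x.+1 | z == y.+1].

(** A new last point gains [m+2] triples through its predecessor and [2m+1] others, again [3m+3] in
    total. *)
Lemma triples_star_adjacent n : 3 <= n ->
  triples star_adjacent n = 'C(n, 3) - 'C(n - 3, 3).
Proof.
have rowE m : \sum_(x < m.+2) ((x == 0 :> nat) || (m.+2 == x.+1)) = 2.
  rewrite (eq_bigr (fun x : 'I_m.+2 => (x == 0 :> nat) + (x == m.+1 :> nat))).
    by rewrite big_split /= !sum_eqn; lia.
  by move=> x _; rewrite eqSS; lia.
have pairE m : pairs (fun x y => (x == 0) || (y == x.+1)) m.+2 = m.*2.+1.
  elim: m => [|m IHm]; last by rewrite pairsS IHm rowE; lia.
  by rewrite !(pairsS, pairs0, big_ord_recr, big_ord0).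
elim: n => [|[|[|m] IHm]] // _; case: m IHm => [|m] IHm.
  by rewrite !(triplesS, pairsS, triples0, pairs0, big_ord_recr, big_ord0).
rewrite triplesS IHm // pairsS.
rewrite (@eq_pairs _ (fun x y => (x == 0) || (y == x.+1))) ?pairE; last first.
  by move=> x y xy; rewrite /star_adjacent; lia.
rewrite (eq_bigr (fun=> 1)) => [|x _]; last by rewrite /star_adjacent eqxx !orbT.
rewrite sum1_card card_ord.
have -> : m.+4 - 3 = m.+1 by lia.
have -> : m.+3 - 3 = m by lia.
have C1 : 'C(m.+4, 3) = 'C(m.+3, 3) + 'C(m.+3, 2) by rewrite (binS _ 2).
have C2 : 'C(m.+1, 3) = 'C(m, 3) + 'C(m, 2) by rewrite (binS _ 2).
have C3 : 'C(m.+3, 2) = 'C(m, 2) + (m + m.+1 + m.+2).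
  by rewrite !(binS _ 1) !bin1; lia.
have C4 : 'C(m, 3) <= 'C(m.+3, 3) by rewrite leq_bin2l // !leqW.
by lia.
Qed.

(** In a copy of [M3] any two vertices of one triple are separated by vertices of the other, so
    neither triple has two adjacent points. In the example both would then contain 0, but they are
    disjoint. *)
Lemma ex_cyc_M3 n : 3 <= n -> ex_cyc n M3 = 'C(n, 3) - 'C(n - 3, 3).
Proof.
case: n => // n n3; apply: (@ex_cyc_eq _ _ _ _ star_adjacent).
- move=> H cghH nF; rewrite card_cgh //; apply: triples_M3_free => //.
  move=> a b c d e f abc cde ef; apply: contraNN nF => /andP[T1 T2].
  by apply: (@contains_pairI _ _ _ [:: a; b; c; d; e; f]) => //=; lia.
- apply/negP => /contains_pairP[f cycf]; rewrite !imset_set3 => -[T1 T2].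
  have cyc i j k : i < j < k -> k < 6 ->
      cyc_lt (f (inord i)) (f (inord j)) (f (inord k)).
    by move=> ijk k6; apply: cycf; rewrite !inordK; lia.
  have := set3_cgh_of (cyc 0 2 4 isT isT) T1.
  have := set3_cgh_of (cyc 1 3 5 isT isT) T2.
  have := cyc 0 1 2 isT isT; have := cyc 0 2 3 isT isT.
  have := cyc 0 3 4 isT isT; have := cyc 0 4 5 isT isT.
  rewrite /cyc_lt /star_adjacent; move: (f _) (f _) (f _) (f _) (f _) (f _).
  move=> x0 x1 x2 x3 x4 x5; lia.
- exact: triples_star_adjacent.
Qed.

(** * The configuration S3 *)

Lemma pairs_point a b n : pairs (fun x y => (x == a) && (y == b)) n <= 1.
Proof.
rewrite /pairs (eq_bigr (fun y : 'I_n => if y == b :> nat then (a < y : nat) else 0)).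
  rewrite -big_mkcond /=; apply: (@leq_trans (\sum_(y < n) (y == b :> nat))).
    by rewrite big_mkcond; apply: leq_sum => y _; case: (_ == b) => //; apply: leq_b1.
  by rewrite sum_eqn; case: (b < n).
move=> y _; case: eqP => _; last by rewrite big1 // => x _; rewrite andbF.
by rewrite -sum_eqn; apply: eq_bigr => x _; rewrite andbT.
Qed.

Definition boundary m (x y : nat) : bool :=
  (y == x.+1) || (x == 0) && (y == m.-1).

Lemma pairs_boundary m : 3 <= m -> pairs (boundary m) m = m.
Proof.
case: m => [|[|[|m]]] // _; rewrite pairsS.
rewrite (@eq_pairs _ (fun x y => y == x.+1)); last first.
  by move=> x y xy; rewrite /boundary /=; lia.
rewrite (eq_bigr (fun x : 'I_m.+2 => (x == m.+1 :> nat) + (x == 0 :> nat))).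
  rewrite big_split /= !sum_eqn.
  suff -> : pairs (fun x y => y == x.+1) m.+2 = m.+1 by lia.
  elim: m => [|m IHm]; first by rewrite !(pairsS, pairs0, big_ord_recr, big_ord0).
  rewrite pairsS IHm (eq_bigr (fun x : 'I_m.+2 => (x == m.+1 :> nat) : nat)).
    by rewrite sum_eqn; lia.
  by move=> x _; rewrite eqSS eq_sym.
by move=> x _; rewrite /boundary eqSS /=; lia.
Qed.

(** A side crosses nothing, so all [m] sides can be added before applying the bound [2m - 3]. *)
Lemma noncrossing_diagonals (e : rel nat) m : 3 <= m ->
  (forall a b c d, a < b < c -> c < d < m -> ~~ (e a c && e b d)) ->
  pairs (fun x y => e x y && ~~ boundary m x y) m <= m - 3.
Proof.
move=> m3 ncr.
have := @noncrossing_pairs (fun x y => e x y && ~~ boundary m x y || boundary m x y) m.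
rewrite (@eq_pairs _ (fun x y => (e x y && ~~ boundary m x y) + boundary m x y)).
  rewrite pairsD pairs_boundary // => le.
  have {}le := le (ltnW m3) _; rewrite -(leq_add2r m); apply: leq_trans (le _) _.
    by move=> a b c d abc cd; have := ncr a b c d; rewrite /boundary; lia.
  by lia.
by move=> x y _; case: (boundary _ _ _); case: (e x y).
Qed.

Definition adj n (x y : nat) : bool :=
  (x.+1 == y %[mod n]) || (y.+1 == x %[mod n]).

Lemma adjC n x y : adj n x y = adj n y x.
Proof. exact: orbC. Qed.

Lemma adjDr n x y : adj n (x + n) y = adj n x y.
Proof. by rewrite /adj -addSn !modnDr. Qed.

Lemma adjE n x y : 2 < n -> x < y < n ->
  adj n x y = (y == x.+1) || (x == 0) && (y == n.-1).
Proof.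
move=> n3 xy; rewrite /adj (modn_small (m := x)) 1?(modn_small (m := y)); try lia.
rewrite modn_small; last by lia.
have [yn|yn] := eqVneq y.+1 n; first by rewrite yn modnn; lia.
by rewrite modn_small; lia.
Qed.

(** For distinct residues and [n >= 4], two adjacent pairs mean a triple [{i, i+1, i+2}] modulo
    [n]. *)
Definition consecutive n (x y z : nat) : bool :=
  adj n x y + adj n y z + adj n x z >= 2.

Lemma triples_consecutive n : 4 <= n -> triples (consecutive n) n <= n.
Proof.
case: n => // k k3; rewrite triplesS.
(* The consecutive triples through the last point [k] are [{0, 1, k}], [{0, k-1, k}] and
   [{k-2, k-1, k}]. *)
have top : pairs (fun x y => consecutive k.+1 x y k) k <= 3.
  apply: (@leq_trans (pairs (fun x y => ((x == 0) && (y == 1))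
    + ((x == 0) && (y == k.-1)) + ((x == k.-2) && (y == k.-1))) k)).
    apply: leq_pairs => x y xy; rewrite /consecutive !adjE; lia.
  rewrite !pairsD; have := pairs_point 0 1 k; have := pairs_point 0 k.-1 k.
  have := pairs_point k.-2 k.-1 k; move: (pairs _ _) (pairs _ _) (pairs _ _).
  by move=> p q r; lia.
suff low : triples (consecutive k.+1) k <= k - 2.
  by apply: leq_trans (leq_add low top) _; lia.
rewrite (@eq_triples _ (fun x y z => (y == x.+1) && (z == x.+2))); last first.
  by move=> x y z xyz zk; rewrite /consecutive !adjE; lia.
elim: k {k3 top} => [|k IHk]; first by rewrite triples0.
have [k2|k2] := ltnP k 2.
  by case: k k2 {IHk} => [|[|]];
       rewrite ?(triplesS, pairsS, triples0, pairs0, big_ord_recr, big_ord0).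
rewrite triplesS subSn // -addn1; apply: leq_add => //.
apply: leq_trans (pairs_point k.-2 k.-1 k).
by apply: leq_pairs => x y xy; lia.
Qed.

(** The link of [v] lives on the polygon without [v], whose sides are the old sides and the pair of
    neighbours of [v]. The latter makes a consecutive triple with [v], so excluding these leaves
    true diagonals. *)
Definition link_diagonal n (h : nat -> rel nat) (v x y z : nat) : bool :=
  [&& h x y z, ~~ consecutive n x y z &
  [|| (x == v %[mod n]) && ~~ adj n y z, (y == v %[mod n]) && ~~ adj n x z
    | (z == v %[mod n]) && ~~ adj n x y]].

Lemma link_diagonal_cyclic n (h : nat -> rel nat) v :
  cyclic_fun n h -> cyclic_fun n (link_diagonal n h v).
Proof.
move=> [hC hA hn]; rewrite /link_diagonal /consecutive; split=> x y z.
- rewrite hC (adjC n y x).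
  by case: (h x y z); case: (adj n x y); case: (adj n x z); case: (adj n y z);
    case: (x == v %[mod n]); case: (y == v %[mod n]); case: (z == v %[mod n]).
- rewrite hA (adjC n z y).
  by case: (h x y z); case: (adj n x y); case: (adj n x z); case: (adj n y z);
    case: (x == v %[mod n]); case: (y == v %[mod n]); case: (z == v %[mod n]).
- by rewrite hn !adjDr modnDr.
Qed.

Lemma triples_S3_free (h : nat -> rel nat) n : 4 <= n -> cyclic_fun n h ->
  (forall a b c d e, a < b < c -> c < d < e -> e < a + n ->
     ~~ (h a b d && h a c e)) ->
  (triples h n).*2 <= n * (n - 2).
Proof.
move=> n4 hcyc hfree.
have link_le v : triples (link_diagonal n h v) n <= n - 4.
  have := link_diagonal_cyclic v hcyc; move: (hcyc) => [_ _ hn] [lC lA ln].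
  have {lC lA ln} rot : cyclic_fun n (fun x y z => link_diagonal n h v x y z : nat).
    by split=> x y z; [rewrite lC | rewrite lA | rewrite ln].
  (* After [v] is rotated to position 0, exactly the triples with least vertex 0 pass through it. *)
  rewrite -(triples_rot v rot) {rot}.
  case: n n4 {hcyc} hfree hn => // m m3 hfree hn.
  rewrite triples_recl [X in _ + X](_ : _ = 0) ?addn0; last first.
    rewrite /triples big1 // => z _; rewrite /pairs big1 // => y _.
    rewrite big1 // => x _; rewrite /link_diagonal.
    have neq w : w < z.+1 -> (w.+1 + v == v %[mod m.+1]) = false.
      move=> wz; apply/negbTE; rewrite -[X in _ == X %[mod _]]add0n eqn_modDr.
      by rewrite mod0n modn_small //; have := ltn_ord z; lia.
    have := ltn_ord x; have := ltn_ord y => yz xy.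
    by rewrite !neq ?andbF //; lia.
  have := @noncrossing_diagonals (fun x y => h v (x.+1 + v) (y.+1 + v)) m m3.
  rewrite subSS; move=> le; apply: leq_trans (le _); last first.
    move=> a b c d abc cd.
    by have := hfree v (a.+1 + v) (b.+1 + v) (c.+1 + v) (d.+1 + v); lia.
  apply: leq_pairs => x y xy; rewrite /link_diagonal add0n.
  have neq w : w < m -> (w.+1 + v == v %[mod m.+1]) = false.
    move=> wz; apply/negbTE; rewrite -[X in _ == X %[mod _]]add0n eqn_modDr.
    by rewrite mod0n modn_small; lia.
  rewrite eqxx !neq /=; try lia.
  case: (h v _ _) => //=; rewrite orbF /boundary.
  have [->|_] /= := eqVneq y x.+1; first by rewrite /adj addSn eqxx andbF.
  case: ((x == 0) && (y == m.-1)) / boolP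
    => [/andP[/eqP-> /eqP->]|_] /=; last exact: leq_b1.
  have adj_next : adj m.+1 v (1 + v) by rewrite /adj add1n eqxx.
  have adj_prev : adj m.+1 v (m.-1.+1 + v).
    by rewrite /adj -addSn (_ : m.-1.+2 = m.+1) ?modnDl ?eqxx ?orbT //; lia.
  by rewrite /consecutive adj_next adj_prev; case: (adj _ _ _).
(* Double counting: a triple that is not consecutive has at most one adjacent pair, hence at least
   two vertices facing a diagonal. *)
have h_le : (triples (fun x y z => h x y z && ~~ consecutive n x y z) n).*2
    <= \sum_(v < n) triples (link_diagonal n h v) n.
  rewrite (triples_sum n (fun v x y z => link_diagonal n h v x y z)) -addnn -triplesD.
  apply: leq_triples => x y z xyz zn.
  have [hxyz|] := boolP (h x y z && _) => //.
  rewrite (eq_bigr (fun v : 'I_n => (v == x :> nat) * ~~ adj n y z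
     + (v == y :> nat) * ~~ adj n x z + (v == z :> nat) * ~~ adj n x y)).
    rewrite !big_split -!big_distrl /= !sum_eqn.
    move: hxyz => /andP[_]; rewrite /consecutive.
    have [-> -> ->] : [/\ x < n, y < n & z < n] by split; lia.
    by case: (adj n x y); case: (adj n x z); case: (adj n y z).
  move=> v _; rewrite /link_diagonal andbA hxyz /= !modn_small
    ?(eq_sym x) ?(eq_sym y) ?(eq_sym z); try lia.
  have := ltn_ord v.
  case: (adj n x y); case: (adj n x z); case: (adj n y z); lia.
have sum_le : \sum_(v < n) triples (link_diagonal n h v) n <= n * (n - 4).
  by rewrite -[n in n * _]card_ord -sum_nat_const; apply: leq_sum => v _.
have split_le : triples h n <=
    triples (fun x y z => h x y z && ~~ consecutive n x y z) n + n.
  apply: leq_trans (leq_add (leqnn _) (triples_consecutive n4)).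
  rewrite -triplesD; apply: leq_triples => x y z _ _.
  by case: (h _ _ _) => //; case: (consecutive _ _ _ _).
have := leq_trans h_le sum_le; move: split_le.
move: (triples _ _) (triples _ _) => p q; rewrite !mulnBr; nia.
Qed.

(** Matched points are consecutive numbers, so in an increasing triple only neighbouring entries can
    match. *)
Definition same_half (x y z : nat) : bool := (x./2 == y./2) || (y./2 == z./2).

Lemma triples_same_half m : triples same_half m.*2 = m * m.-1 * 2.
Proof.
have pairE k : pairs (fun x y => x./2 == y./2) k = k./2.
  elim: k => [|k IHk]; first by rewrite pairs0.
  rewrite pairsS IHk (eq_bigr (fun x : 'I_k =>
    if odd k then (x == k.-1 :> nat : nat) else 0)).
    rewrite -big_mkcond /=; case: (boolP (odd k)) => ok.
      by rewrite sum_eqn; lia.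
    by rewrite big_pred0 //; lia.
  by move=> x _; have := ltn_ord x; case: ifP; lia.
elim: m => [|m IHm]; first by rewrite triples0.
rewrite doubleS 2!triplesS IHm pairsS.
rewrite (@eq_pairs _ (fun x y => x./2 == y./2)) ?pairE; last first.
  by move=> x y xy; rewrite /same_half; lia.
rewrite (@eq_pairs _ (fun x y => x./2 == y./2)) ?pairE; last first.
  by move=> x y xy; rewrite /same_half; lia.
rewrite (eq_bigr (fun=> 1)) => [|x _]; last by rewrite /same_half; have := ltn_ord x; lia.
by rewrite sum1_card card_ord; nia.
Qed.

(** In a copy of [S3] the only pair of the first triple not separated by the second is [{x_1, x_2}],
    and conversely it is [{x_1, x_5}]. In the example [x_1] would have two partners in the
    matching. *)
Lemma ex_cyc_S3 n : 4 <= n -> ~~ odd n -> ex_cyc n S3 = (n * (n - 2)) %/ 2.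
Proof.
case: n => // n n3 evn; apply: (@ex_cyc_eq _ _ _ _ same_half).
- move=> H cghH nF; rewrite card_cgh //.
  suff : (triples (tri H) n.+1).*2 <= n.+1 * (n.+1 - 2).
    by rewrite leq_divRL // muln2.
  apply: triples_S3_free => //; first exact: tri_cyclic.
  move=> a b c d e abc cde ea; apply: contraNN nF => /andP[T1 T2].
  by apply: (@contains_pairI _ _ _ [:: a; b; c; d; e]) => //=; lia.
- apply/negP => /contains_pairP[f cycf]; rewrite !imset_set3 => -[T1 T2].
  have cyc i j k : i < j < k -> k < 5 ->
      cyc_lt (f (inord i)) (f (inord j)) (f (inord k)).
    by move=> ijk k6; apply: cycf; rewrite !inordK; lia.
  have := set3_cgh_of (cyc 0 1 3 isT isT) T1.
  have := set3_cgh_of (cyc 0 2 4 isT isT) T2.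
  have := cyc 0 1 2 isT isT; have := cyc 0 2 3 isT isT.
  have := cyc 0 3 4 isT isT.
  rewrite /cyc_lt /same_half; move: (f _) (f _) (f _) (f _) (f _).
  move=> x0 x1 x2 x3 x4; lia.
- rewrite -[n.+1]odd_double_half (negbTE evn) add0n triples_same_half.
  by rewrite (_ : _ * (_ - 2) = (n.+1)./2 * (n.+1)./2.-1 * 2 * 2) ?mulnK //; nia.
Qed.

(** * The configuration M2 *)

Definition M2_free n (h : nat -> rel nat) : Prop :=
  forall a b c d e f, a < b < c -> c < d < e -> e < f < a + n ->
    ~~ (h a b d && h c e f).

(* The rotations of the pattern x1 x2 x4 | x3 x5 x6 other than the trivial one,
   written with the vertices of each triple in increasing order. *)
Lemma M2_free_rot n (h : nat -> rel nat) a b c d e f :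
  cyclic_fun n h -> M2_free n h ->
  a < b < c -> c < d < e -> e < f < a + n ->
  [/\ ~~ (h a c f && h b d e), ~~ (h b e f && h a c d),
      ~~ (h a d e && h b c f), ~~ (h c d f && h a b e) & ~~ (h b c e && h a d f)].
Proof.
move=> [hC hA hn] free abc cde ef.
have hr x y z : h y z (x + n) = h x y z by rewrite hA hC hn.
have hrr x y z : h z (x + n) (y + n) = h x y z by rewrite !hr.
have hrrr x y z : h (x + n) (y + n) (z + n) = h x y z by rewrite hn !hr hA hC.
split.
- by have := free f (a + n) (b + n) (c + n) (d + n) (e + n); rewrite hrr hrrr; lia.
- by have := free e f (a + n) (b + n) (c + n) (d + n); rewrite hr hrrr; lia.
- by have := free d e f (a + n) (b + n) (c + n); rewrite hr hrr; lia.
- by have := free c d e f (a + n) (b + n); rewrite hrr; lia.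
- by have := free b c d e f (a + n); rewrite hr; lia.
Qed.


(** * The case of seven points for [M2], by exhaustive search *)

Definition triple := (nat * nat * nat)%type.

(* The six cyclic rotations of the word AABABB, read from the smallest vertex. *)
Definition M2_word (p : triple * triple) : bool :=
  let: ((a, b, c), (a', b', c')) := p in
  [|| [&& a < b, b < a', a' < c, c < b' & b' < c'],
      [&& a < a', a' < b, b < b', b' < c' & c' < c],
      [&& a' < a, a < b', b' < c', c' < b & b < c],
      [&& a < a', a' < b', b' < b, b < c & c < c'],
      [&& a' < b', b' < a, a < b, b < c' & c' < c]
    | [&& a' < a, a < b, b < b', b' < c & c < c']].

Definition M2_pair (s t : triple) : bool := M2_word (s, t) || M2_word (t, s).

(* Size of a largest r-independent subsequence of s.  A head without conflicts is
   taken at once, which keeps the search small; k is fuel. *)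
Fixpoint alpha (T : Type) (r : rel T) (k : nat) (s : seq T) : nat :=
  if k is k'.+1 then
    if s is x :: s' then
      let t := [seq y <- s' | ~~ r x y] in
      if size t == size s' then (alpha r k' s').+1
      else maxn (alpha r k' s') (alpha r k' t).+1
    else 0
  else size s.

Fixpoint all_pairs n : seq (nat * nat) :=
  if n is m.+1 then all_pairs m ++ [seq (x, m) | x <- iota 0 m] else [::].

Fixpoint all_triples n : seq triple :=
  if n is m.+1 then all_triples m ++ [seq (p, m) | p <- all_pairs m] else [::].

Lemma count_iota (p : pred nat) n : count p (iota 0 n) = \sum_(x < n) p x.
Proof.
rewrite -sum1_count big_mkcond -[n in iota 0 n]subn0 big_mkord.
by apply: eq_bigr => x _; case: (p x).
Qed.

Lemma count_all_pairs (e : rel nat) n :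
  count (fun p => e p.1 p.2) (all_pairs n) = pairs e n.
Proof.
elim: n => [|n IHn]; first by rewrite pairs0.
by rewrite /= count_cat IHn pairsS count_map count_iota.
Qed.

Lemma count_all_triples (h : nat -> rel nat) n :
  count (fun t => h t.1.1 t.1.2 t.2) (all_triples n) = triples h n.
Proof.
elim: n => [|n IHn]; first by rewrite triples0.
rewrite /= count_cat IHn triplesS count_map; congr (_ + _).
exact: (count_all_pairs (fun x y => h x y n)).
Qed.

(** The elements satisfying [p] are independent: if [x] is one of them, deleting its conflicts does
    not change the count on the tail. *)
Lemma count_alpha (T : eqType) (r : rel T) (p : pred T) k (s : seq T) :
  {in s &, forall x y, r x y -> ~~ (p x && p y)} -> count p s <= alpha r k s.
Proof.
elim: k s => [|k IHk] [|x s] //= rP; first exact: (count_size p (x :: s)).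
have IHs : count p s <= alpha r k s.
  by apply: IHk => y z ys zs; apply: rP; rewrite inE ?ys ?zs orbT.
case: ifP => _; first by rewrite -add1n leq_add // leq_b1.
have [px|] := boolP (p x); last by rewrite leq_max IHs.
rewrite leq_max add1n ltnS; apply/orP; right.
have -> : count p s = count p [seq y <- s | ~~ r x y].
  rewrite count_filter; apply: eq_in_count => y ys /=.
  have := rP x y; rewrite !inE eqxx ys orbT px => /(_ isT isT).
  by case: (r x y) => [/(_ isT) /= /negbTE ->|_]; rewrite ?andbT ?andbF.
apply: IHk => y z; rewrite !mem_filter => /andP[_ ys] /andP[_ zs].
by apply: rP; rewrite inE ?ys ?zs orbT.
Qed.

Lemma mem_all_triples n t : t \in all_triples n -> t.1.1 < t.1.2 < t.2 /\ t.2 < n.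
Proof.
elim: n => //= n IHn; rewrite mem_cat => /orP[/IHn[-> /ltnW]//|].
case/mapP=> -[x y] /= xy ->; split => //.
elim: n xy {IHn} => //= n IHn; rewrite mem_cat => /orP[/IHn|]; first by lia.
by case/mapP => u; rewrite mem_iota => un [-> ->]; lia.
Qed.

(** The triples in [h] are independent in the conflict graph [M2_pair]. The fuel 35 is the number of
    triples of seven points, and 19 is ['C(7, 2) - 2]. *)
Lemma triples_M2_free7 (h : nat -> rel nat) :
  cyclic_fun 7 h -> M2_free 7 h -> triples h 7 <= 19.
Proof.
move=> hcyc free; rewrite -count_all_triples.
have <- : alpha M2_pair 35 (all_triples 7) = 19 by vm_compute.
apply: count_alpha => s t /mem_all_triples + /mem_all_triples.
have word a b c a' b' c' : c < 7 -> c' < 7 -> M2_word (a, b, c, (a', b', c')) ->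
    ~~ (h a b c && h a' b' c').
  move=> c7 c7' /or4P[| | |/or3P[]] /and5P[? ? ? ? ?].
  - by apply: free; lia.
  - by have [|||+ _ _ _ _] := @M2_free_rot 7 h a a' b b' c' c hcyc free;
      rewrite 1?andbC; try lia.
  - by have [|||_ + _ _ _] := @M2_free_rot 7 h a' a b' c' b c hcyc free;
      rewrite 1?andbC; try lia.
  - by have [|||_ _ + _ _] := @M2_free_rot 7 h a a' b' b c c' hcyc free;
      rewrite 1?andbC; try lia.
  - by have [|||_ _ _ + _] := @M2_free_rot 7 h a' b' a b c' c hcyc free;
      rewrite 1?andbC; try lia.
  - by have [|||_ _ _ _ +] := @M2_free_rot 7 h a' a b b' c c' hcyc free;
      rewrite 1?andbC; try lia.
case: s t => [[a b] c] [[a' b'] c'] /= [_ c7] [_ c7'].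
by case/orP => /word; rewrite 1?andbC; apply.
Qed.

(** * Chords on adjacent pairs *)

Lemma cyclic_fun_mul n (h : nat -> rel nat) p q r x y z : cyclic_fun n h ->
  h (p * n + x) (q * n + y) (r * n + z) = h x y z.
Proof.
move=> [hC hA hn].
have hmul k u v w : h (k * n + u) v w = h u v w.
  by elim: k => // k <-; rewrite -[RHS]hn mulSn; congr h; lia.
by rewrite hmul hC hmul hC hA hC hmul hC hA.
Qed.

Lemma chord_mod n (h : nat -> rel nat) i a b : cyclic_fun n h ->
  h (i %% n) (i %% n + a) (i %% n + b) = h i (i + a) (i + b).
Proof.
move=> hcyc; have := divn_eq i n; set q := i %/ n; set r := i %% n => ->.
by rewrite -!addnA cyclic_fun_mul.
Qed.

(** Give the chords [{j, j+1, j+k}] and [{j, j+k-1, j+k}] the length [k]. Were there two chords at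
    every pair, one of length at least 4 could always be selected, and descent on the length would
    never end. *)
Lemma M2_free_few_chords n (h : nat -> rel nat) : 6 <= n ->
  cyclic_fun n h -> M2_free n h ->
  exists i, forall a b, 2 < a < b -> b < n.-1 ->
    ~~ (h i i.+1 (i + a) && h i i.+1 (i + b)).
Proof.
move=> n6 hcyc free; have [hC hA hn] := hcyc.
have rot := fun a b c d e f => @M2_free_rot n h a b c d e f hcyc free.
pose two_chords i := [exists a : 'I_n, exists b : 'I_n,
  [&& 2 < a < b, b < n.-1 & h i i.+1 (i + a) && h i i.+1 (i + b)]].
have [/existsP[i few]|/existsPn many] := boolP [exists i : 'I_n, ~~ two_chords i].
  exists i => a b ab bn; apply: contraNN few => hab.
  have [an bn'] : a < n /\ b < n by lia.
  apply/existsP; exists (Ordinal an); apply/existsP; exists (Ordinal bn').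
  by rewrite ab bn hab.
have {}many i : exists a b, [/\ 2 < a < b, b < n.-1, h i i.+1 (i + a)
    & h i i.+1 (i + b)].
  have n0 : 0 < n by lia.
  have := many (Ordinal (ltn_pmod i n0)); rewrite negbK.
  case/existsP=> a /existsP[b /and3P[ab bn /=]].
  rewrite -addn1 !chord_mod // addn1 => /andP[ha hb].
  by exists a, b.
(* Below a shortest chord, the pair next to its far end has no room for two chords. *)
suff none k j : 4 <= k -> k < n.-1 ->
    ~~ h j j.+1 (j + k) /\ ~~ h j (j + k.-1) (j + k).
  have [a [b [ab bn _ hb]]] := many 0.
  have [||/negP//] := none b 0; lia.
elim/ltn_ind: k j => k IHk j k4 kn; split; apply/negP => hj.
  (* The smaller offset [a] is used: seen from the other side, its chord has length [n + 1 - a],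
     which is at least 4. *)
  have [a [b [ab bn ha _]]] := many (j + k.-2).
  have [far|near] := ltnP (j + k.-2 + a) (j + n).
    by have [|||_ _ _ + _] := rot j j.+1 (j + k.-2) (j + k.-2).+1 (j + k)
      (j + k.-2 + a); lia.
  have [|||_] := IHk (n.+1 - a) _ (j + k.-2 + a - n); try lia.
  rewrite (_ : _ - n + (n.+1 - a).-1 = j + k.-2); last by lia.
  rewrite (_ : _ - n + (n.+1 - a) = (j + k.-2).+1); last by lia.
  by rewrite -(hn (_ - n)) subnK; [rewrite hC hA ha | lia].
(* Here the larger offset [b] is at least 4, as the induction hypothesis requires. *)
have [a [b [ab bn _ hb]]] := many j.+1.
have [far|near] := ltnP k.-1 b.
  by have [|||_ _ + _ _] := rot j j.+1 j.+2 (j + k.-1) (j + k) (j.+1 + b); lia.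
have [|||/negP//] := IHk b _ j.+1; lia.
Qed.

Lemma pairs_star c (q : pred nat) m :
  pairs (fun x y => (x == c) && q y || (y == c) && q x) m
    <= \sum_(z < m) ((z != c :> nat) && q z).
Proof.
elim: m => [|m IHm]; first by rewrite pairs0.
rewrite pairsS; have [<-|mc] := eqVneq m c.
  rewrite (@eq_pairs _ (fun _ _ => 0)) => [|x y xy]; last first.
    by case/andP: xy => xy ym; rewrite !ltn_eqF // (ltn_trans xy).
  rewrite [X in X + _](_ : _ = 0) ?add0n; last first.
    by rewrite /pairs big1 // => y _; rewrite big1.
  rewrite [leqRHS]big_ord_recr /= eqxx addn0; apply: leq_sum => x _.
  by rewrite ltn_eqF.
rewrite [leqRHS]big_ord_recr /= mc leq_add //=.
apply: leq_trans (_ : \sum_(x < m) (x == c :> nat) * q m <= _).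
  by apply: leq_sum => x _; rewrite orbF; case: (_ == c); case: (q m).
by rewrite -big_distrl /= sum_eqn; case: (c < m); case: (q m).
Qed.

(** Pairwise intersecting edges form a star or a triangle. A star lacking a spoke has at most
    [m - 2] edges, and so has a triangle since [m >= 5]. *)
Lemma intersecting_pairs (e : rel nat) m : 5 <= m -> symmetric e ->
  (forall a b c d, a < b < m -> a < c < d -> d < m -> b != c -> b != d ->
     ~~ (e a b && e c d)) ->
  pairs e m <= m - 2 \/
  (exists2 c, c < m & forall b, b < m -> b != c -> e c b) /\ pairs e m <= m - 1.
Proof.
move=> m5 eC int.
have eE a b : e (minn a b) (maxn a b) = e a b.
  by have [ab|ba] := leqP a b; last rewrite eC.
have {}int a b c d : a < m -> b < m -> c < m -> d < m -> a != b -> c != d ->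
    e a b -> e c d -> [|| a == c, a == d, b == c | b == d].
  move=> am bm cm dm ab cd; rewrite -eE -[e c d]eE => hab hcd.
  apply: contraT => neq.
  have [lt|lt] := ltnP (minn a b) (minn c d).
    have := int (minn a b) (maxn a b) (minn c d) (maxn c d).
    by rewrite hab hcd /=; lia.
  have := int (minn c d) (maxn c d) (minn a b) (maxn a b).
  by rewrite hab hcd /=; lia.
pose star c := [forall x : 'I_m, forall y : 'I_m,
  (x < y) && e x y ==> (x == c :> nat) || (y == c :> nat)].
have starP c : ~~ star c ->
    exists x y, [/\ x < m, y < m, x != y, e x y & (x != c) && (y != c)].
  case/forallPn => x /forallPn[y]; rewrite negb_imply => /andP[/andP[xy hxy]].
  rewrite negb_or => xyc; exists x, y; split=> //.
  by rewrite neq_ltn xy.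
have [/existsP[c /forallP starc]|/existsPn nostar] := boolP [exists c : 'I_m, star c].
  have le_star : pairs e m <= \sum_(z < m) ((z != c :> nat) && e c z).
    apply: leq_trans (pairs_star c (e c) m); apply: leq_pairs => x y /andP[xy ym].
    have := starc (Ordinal (ltn_trans xy ym)) => /forallP/(_ (Ordinal ym)) /=.
    rewrite xy /=; case hxy: (e x y) => //= /orP[]/eqP <-; rewrite eqxx ?hxy //.
    by rewrite eC hxy orbT.
  have others : \sum_(z < m) (z != c :> nat) = m - 1.
    have : \sum_(z < m) (z != c :> nat) + \sum_(z < m) (z == c :> nat) = m.
      rewrite -big_split -[RHS]card_ord -sum1_card; apply: eq_bigr => z _ /=.
      by case: eqP.
    by rewrite sum_eqn ltn_ord; lia.
  have [/forallP full|/forallPn[z]] :=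
      boolP [forall z : 'I_m, (z != c :> nat) ==> e c z].
    right; split; first by exists c => // b bm; have /implyP := full (Ordinal bm).
    rewrite -others; apply: leq_trans le_star _.
    by apply: leq_sum => z _; case: (e c z); rewrite ?andbT ?andbF.
  rewrite negb_imply => /andP[zc /negbTE ncz]; left; apply: leq_trans le_star _.
  have : \sum_(y < m) ((y != c :> nat) && e c y) + \sum_(y < m) (y == z :> nat) <= m - 1.
    rewrite -others -big_split; apply: leq_sum => y _ /=.
    have [->|_] := eqVneq (y : nat) z; first by rewrite ncz zc.
    by rewrite addn0; case: (e c y); rewrite ?andbT ?andbF.
  by rewrite sum_eqn ltn_ord; lia.
left; apply: leq_trans (_ : 3 <= _); last by lia.
have m0 : 0 < m by lia.
have [x [y [xm ym xy hxy _]]] := starP _ (nostar (Ordinal m0)).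
(* An edge avoiding [x] must meet [{x, y}] in [y]. *)
have [w [wm yw hyw wx]] : exists w, [/\ w < m, y != w, e y w & w != x].
  have [u [v [um vm uv huv /andP[ux vx]]]] := starP _ (nostar (Ordinal xm)).
  rewrite /= in ux vx.
  case/or4P: (int x y u v xm ym um vm xy uv hxy huv) => /eqP eqs.
  - by rewrite eqs eqxx in ux.
  - by rewrite eqs eqxx in vx.
  - by exists v; rewrite eqs.
  - by exists u; rewrite eqs eC eq_sym.
(* An edge avoiding [y] meets both [{x, y}] and [{y, w}], hence is [{x, w}]. *)
have hxw : e x w.
  have [u [v [um vm uv huv /andP[uy vy]]]] := starP _ (nostar (Ordinal ym)).
  rewrite /= in uy vy.
  case/or4P: (int y w u v ym wm um vm yw uv hyw huv) => /eqP eqs;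
    case/or4P: (int x y u v xm ym um vm xy uv hxy huv) => /eqP eqs';
    do ?[by rewrite ?eqs ?eqs' eqxx in uy | by rewrite ?eqs ?eqs' eqxx in vy
        | by rewrite ?eqs ?eqs' eqxx in wx | by rewrite eqs eqs' // eC].
(* An edge meeting all three sides of a triangle is one of them. *)
apply: (@leq_trans (pairs (fun u v =>
    ((u == minn x y) && (v == maxn x y)) + ((u == minn y w) && (v == maxn y w))
    + ((u == minn x w) && (v == maxn x w))) m)).
  apply: leq_pairs => u v /andP[uv vm]; case huv: (e u v) => //.
  have um := ltn_trans uv vm; have uv' : u != v by rewrite neq_ltn uv.
  have point a b : (a == u) && (b == v) || (a == v) && (b == u) ->
      (u == minn a b) && (v == maxn a b).
    by clear -uv; lia.
  have wx' : x != w by rewrite eq_sym.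
  case/or4P: (int x y u v xm ym um vm xy uv' hxy huv) => /eqP eqs;
    case/or4P: (int y w u v ym wm um vm yw uv' hyw huv) => /eqP eqs';
    case/or4P: (int x w u v xm wm um vm wx' uv' hxw huv) => /eqP eqs'';
    do ?[by rewrite ?(eqs, eqs', eqs'') eqxx in xy
        | by rewrite ?(eqs, eqs', eqs'') eqxx in yw
        | by rewrite ?(eqs, eqs', eqs'') eqxx in wx
        | by rewrite ?eqs ?eqs' ?eqs'' eqxx in xy
        | by rewrite (point x y) // ?eqs ?eqs' ?eqs'' !eqxx ?orbT
        | by rewrite (point y w) ?addn1 // ?eqs ?eqs' ?eqs'' !eqxx ?orbT
        | by rewrite (point x w) ?addn1 // ?eqs ?eqs' ?eqs'' !eqxx ?orbT].
by rewrite !pairsD -[3]/(1 + 1 + 1) !leq_add ?pairs_point.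
Qed.

(** All triples of the centre [i + c], one of [i] and [i+1], and any further point are present.
    Whatever the third vertex of a chord beside the centre, one of these triples completes it to a
    copy of [M2]. *)
Lemma full_star_no_chord n (h : nat -> rel nat) i c : 8 <= n ->
  cyclic_fun n h -> M2_free n h -> 1 < c < n ->
  (forall b, 1 < b < n -> b != c ->
     h i (i + c) (i + b) && h i.+1 (i + c) (i + b)) ->
  exists j, forall a, 2 < a < n.-1 -> ~~ h j j.+1 (j + a).
Proof.
move=> n8 hcyc free cn star; have [hC hA hn] := hcyc.
have rot a b d e f g := @M2_free_rot n h a b d e f g hcyc free.
have hr x y z : h y z (x + n) = h x y z by rewrite hA hC hn.
have star_r b x : 1 < b < n -> b != c -> x = i + n \/ x = (i + n).+1 ->
    h (i + c) (i + b) x.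
  move=> bn bc; have /andP[s0 s1] := star b bn bc.
  by case=> ->; rewrite -?addSn hr.
have star_m b x : 1 < b < n -> b != c -> x = i + n \/ x = (i + n).+1 ->
    h (i + c) x (i + n + b).
  move=> bn bc xE; rewrite addnAC hr hC; exact: star_r.
(* The pair just after the centre serves unless it is [{i, i+1}] itself; then the pair just before
   the centre does. *)
have [c_last|c_last] := eqVneq c n.-1.
  exists (i + n - 3) => a an; apply/negP => ha.
  have [a3|a3] := eqVneq a 3.
    have s : h (i + c) (i + n).+1 (i + n + 2) by apply: star_m; lia.
    rewrite a3 in ha.
    have := free (i + n - 3) (i + n - 3).+1 (i + c) (i + n - 3 + 3) (i + n).+1
      (i + n + 2).
    by rewrite ha s; lia.
  have s : h (i + c) (i + n) (i + n + (n - 4)) by apply: star_m; lia.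
  by have [|||_ _ _ + _] := rot (i + n - 3) (i + n - 3).+1 (i + c) (i + n)
    (i + n - 3 + a) (i + n + (n - 4)); lia.
exists (i + c).+1 => a an; apply/negP => ha.
have [c4|c4] := leqP c (n - 4).
  have s x : x = i + n \/ x = (i + n).+1 -> h (i + c) (i + c + 3) x.
    by rewrite -addnA; apply: star_r; lia.
  have [q_lt|q_gt|q_eq] := ltngtP ((i + c).+1 + a) (i + n).
  - have {}s := s (i + n) (or_introl erefl).
    by have [|||_ _ _ _ +] := rot (i + c) (i + c).+1 (i + c).+2 (i + c + 3)
      ((i + c).+1 + a) (i + n); lia.
  - have {}s := s (i + n) (or_introl erefl).
    by have [|||_ _ + _ _] := rot (i + c) (i + c).+1 (i + c).+2 (i + c + 3)
      (i + n) ((i + c).+1 + a); lia.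
  - have {}s := s (i + n).+1 (or_intror erefl); rewrite q_eq in ha.
    by have [|||_ _ _ _ +] := rot (i + c) (i + c).+1 (i + c).+2 (i + c + 3)
      (i + n) (i + n).+1; lia.
have [q_eq|q1] := eqVneq ((i + c).+1 + a) (i + n).+1.
  have s : h (i + c) (i + n) (i + n + 2) by apply: star_m; lia.
  rewrite q_eq in ha.
  by have [|||_ _ _ _ +] := rot (i + c) (i + c).+1 (i + c).+2 (i + n)
      (i + n).+1 (i + n + 2); lia.
have [q_eq|q2] := eqVneq ((i + c).+1 + a) (i + n + 2).
  have s : h (i + c) (i + n).+1 (i + n + 3) by apply: star_m; lia.
  rewrite q_eq in ha.
  by have [|||_ _ _ _ +] := rot (i + c) (i + c).+1 (i + c).+2 (i + n).+1
      (i + n + 2) (i + n + 3); lia.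
have s : h (i + c) (i + n).+1 (i + n + 2) by apply: star_m; lia.
by have [|||_ _ + _ _] := rot (i + c) (i + c).+1 (i + c).+2 (i + n).+1
    (i + n + 2) ((i + c).+1 + a); lia.
Qed.

Definition split_last m (b : bool) (x : nat) : nat :=
  if b && (x == m.-1) then m else x.

(* Identifies the points m-1 and m of m+1 points.  At most one vertex of a triple is
   congruent to m-1, so moving all such vertices to m at once does no harm. *)
Definition merged m (h : nat -> rel nat) (x y z : nat) : bool :=
  h (x %% m) (y %% m) (z %% m)
  || h (split_last m true (x %% m)) (split_last m true (y %% m))
       (split_last m true (z %% m)).

Lemma merged_cyclic m h : cyclic_fun m.+1 h -> cyclic_fun m (merged m h).
Proof.
move=> [hC hA _]; rewrite /merged; split=> x y z.
- by rewrite hC [in X in _ || X]hC.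
- by rewrite hA [in X in _ || X]hA.
- by rewrite modnDr.
Qed.

Lemma merged_M2_free m (h : nat -> rel nat) : 0 < m ->
  cyclic_fun m.+1 h -> M2_free m.+1 h -> M2_free m (merged m h).
Proof.
move=> m0 hcyc free.
(* [E] lifts positions to turns of [m+1] points, with [b] choosing the copy of the doubled point. It
   is strictly increasing even between different choices, so the two triples of a pattern may be
   lifted independently. *)
pose E (b : bool) x := x %/ m * m.+1 + split_last m b (x %% m).
have E_lt b b' x y : x < y -> E b x < E b' y.
  move=> xy; rewrite /E /split_last.
  have := divn_eq x m; have := divn_eq y m.
  have := ltn_pmod x m0; have := ltn_pmod y m0.
  have := leq_div2r m (ltnW xy).
  move: (x %/ m) (y %/ m) (x %% m) (y %% m) => q q' r r' qq' r'm rm yE xE.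
  rewrite leq_eqVlt in qq'; case/orP: qq' => [/eqP qE|qq'].
    rewrite qE in xE *; rewrite ltn_add2l.
    by case: b; case: b' => /=; do ?case: eqP => ? /=; lia.
  have : q.+1 * m.+1 <= q' * m.+1 by rewrite leq_mul2r qq' orbT.
  by rewrite mulSn; case: b; case: b' => /=; do ?case: eqP => ? /=; lia.
have E_wrap b x : E b (x + m) = E b x + m.+1.
  by rewrite /E modnDr divnDr // divnn m0 mulnDl mul1n addnAC.
have hE b x y z : h (E b x) (E b y) (E b z) =
    h (split_last m b (x %% m)) (split_last m b (y %% m)) (split_last m b (z %% m)).
  exact: cyclic_fun_mul.
have mergedE x y z : merged m h x y z ->
    exists b, h (E b x) (E b y) (E b z).
  by case/orP => hxyz; [exists false | exists true]; rewrite hE.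
move=> a1 a2 a3 a4 a5 a6 a123 a345 a561; apply/negP.
case/andP => /mergedE[b hb] /mergedE[b' hb'].
have := free (E b a1) (E b a2) (E b' a3) (E b a4) (E b' a5) (E b' a6).
rewrite hb hb' -E_wrap !E_lt; lia.
Qed.

(** The two end positions stand for [i+2] and [i-1], whose triples with [i] and [i+1] are not
    chords. *)
Lemma sum_few_inner (q : pred nat) k b : 2 <= k ->
  \sum_(x < k) ((0 < x < k.-1) && q x) <= b -> \sum_(x < k) q x <= 2 + b.
Proof.
move=> k2 le_b; apply: leq_trans (leq_add (leqnn 2) le_b).
apply: (@leq_trans (\sum_(x < k) ((x == 0 :> nat) + (x == k.-1 :> nat)
                     + ((0 < x < k.-1) && q x)))).
  apply: leq_sum => x _; case: (q x) => //; have := ltn_ord x; lia.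
by rewrite !big_split /= !sum_eqn leq_add2r; case: (0 < k); case: (_ < k).
Qed.

Lemma merge_loss k (h : nat -> rel nat) : 6 <= k ->
  cyclic_fun k.+2 h -> M2_free k.+2 h ->
  exists s, pairs (fun x y => h (x + s) (y + s) (k + s)
                              && h (x + s) (y + s) (k.+1 + s)) k
            + \sum_(x < k) h (x + s) (k + s) (k.+1 + s) <= k.+1.
Proof.
move=> k6 hcyc free; have [hC hA hn] := hcyc.
have rot a b c d e f := @M2_free_rot k.+2 h a b c d e f hcyc free.
have hr x y z : h y z (x + k.+2) = h x y z by rewrite hA hC hn.
pose e i x y := h i (i + x.+2) (i + y.+2) && h i.+1 (i + x.+2) (i + y.+2).
pose q i x := h i i.+1 (i + x.+2).
suff [i le_i] : exists i, pairs (e i) k + \sum_(x < k) q i x <= k.+1.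
  have shiftE x : x + i.+2 = i + x.+2 by lia.
  have lastE : k + i.+2 = i + k.+2 by lia.
  have lastSE : k.+1 + i.+2 = i.+1 + k.+2 by lia.
  (* This shift carries positions [k] and [k+1] to [i] and [i+1] modulo [k+2]. *)
  exists i.+2; apply: leq_trans le_i; apply: eq_leq; congr (_ + _).
    by apply: eq_pairs => x y _; rewrite /e lastE lastSE !shiftE !hr.
  by apply: eq_bigr => x _; rewrite /q lastE lastSE shiftE !hr.
have e_int i : pairs (e i) k <= k - 2 \/
    (exists2 c, c < k & forall b, b < k -> b != c -> e i c b) /\ pairs (e i) k <= k - 1.
  apply: intersecting_pairs => [|x y|a b c d ab cd dk bc bd]; first by lia.
    by rewrite /e hA [h i.+1 _ _]hA.
  apply/negP => /andP[/andP[ab0 ab1] /andP[cd0 cd1]].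
  (* Disjoint pairs are separated, crossing or nested; each way, joining one to [i] and the other to
     [i+1] gives a copy of [M2]. *)
  have [bc'|cb] := ltnP b c.
    by have [|||_ + _ _ _] := rot i i.+1 (i + a.+2) (i + b.+2) (i + c.+2) (i + d.+2); lia.
  have [bd'|db] := ltnP b d.
    by have [|||_ _ _ _ +] := rot i i.+1 (i + a.+2) (i + c.+2) (i + b.+2) (i + d.+2); lia.
  by have [|||+ _ _ _ _] := rot i i.+1 (i + a.+2) (i + c.+2) (i + d.+2) (i + b.+2); lia.
have k2 : 2 <= k by lia.
have n8 : 8 <= k.+2 by lia.
have [i few] := M2_free_few_chords (ltnW (ltnW n8)) hcyc free.
have q_few : \sum_(x < k) q i x <= 2 + 1.
  apply: sum_few_inner => //.
  apply: (@sum_bool_leq1 (fun x => (0 < x < k.-1) && q i x)) => x y xy.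
  apply/negP => /andP[/andP[x0 qx] /andP[y0 qy]].
  by have := few x.+2 y.+2; rewrite -/(q i x) -/(q i y) qx qy; lia.
(* The loss is at most [(k - 2) + 3] without a full star; otherwise a chordless pair [j] gives
   [(k - 1) + 2]. *)
have [Pi|[[c ck star] _]] := e_int i.
  by exists i; apply: leq_trans (leq_add Pi q_few) _; lia.
have [||j none] := @full_star_no_chord k.+2 h i c.+2 n8 hcyc free; first by lia.
  move=> b bn bc; have := star b.-2; rewrite /e (_ : b.-2.+2 = b); last by lia.
  by apply; lia.
have Pj : pairs (e j) k <= k - 1 by have [|[]] := e_int j; lia.
have q_none : \sum_(x < k) q j x <= 2 + 0.
  apply: sum_few_inner => //; rewrite big1 // => x _.
  case: (boolP (0 < x < k.-1)) => //= x0.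
  by have := none x.+2; rewrite -/(q j x); case: (q j x) => //= /(_ _); lia.
by exists j; apply: leq_trans (leq_add Pj q_none) _; lia.
Qed.

Lemma triples_M2_free n (h : nat -> rel nat) : 7 <= n ->
  cyclic_fun n h -> M2_free n h -> triples h n <= 'C(n, 2) - 2.
Proof.
elim: n h => // n IHn h; rewrite leq_eqVlt => /orP[/eqP <-|n7] hcyc free.
  exact: triples_M2_free7.
case: n n7 IHn hcyc free => // k k6 IHn hcyc free; rewrite !ltnS in k6.
have [s loss] := merge_loss k6 hcyc free.
pose g x y z := h (x + s) (y + s) (z + s).
have gcyc : cyclic_fun k.+2 g.
  have [hC hA hn] := hcyc.
  by rewrite /g; split=> x y z; [rewrite hC | rewrite hA | rewrite addnAC hn].
have gfree : M2_free k.+2 g.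
  by move=> a b c d e f abc cde ef; apply: free; lia.
have rotE : triples h k.+2 = triples g k.+2.
  have [hC hA hn] := hcyc; apply/esym.
  apply: (@triples_rot (fun x y z => h x y z : nat)).
  by split=> x y z; [rewrite hC | rewrite hA | rewrite hn].
rewrite rotE (@triples_merge g (merged k.+1 g)).
- have := IHn _ k6 (merged_cyclic gcyc) (merged_M2_free (ltn0Sn k) gcyc gfree).
  rewrite -addnA => le; apply: leq_trans (leq_add le loss) _.
  (* This keeps the truncated subtraction of 2 exact; the allowed loss [k+1] is the growth of the
     binomial. *)
  have : 3 <= 'C(k.+1, 2) by apply: (@leq_bin2l 3 k.+1 2); lia.
  by rewrite (binS k.+1 1) bin1; lia.
- move=> x y z xyz zk; rewrite /merged /split_last !modn_small; try lia.
  by rewrite /= !ltn_eqF ?orbb; lia.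
- move=> x y xy; rewrite /merged /split_last !modn_small; try lia.
  by rewrite /= eqxx !ltn_eqF; lia.
Qed.

(** The consecutive triples that wrap around contain 0 and so fall under [x == 0]. *)
Definition star_consecutive (x y z : nat) : bool :=
  (x == 0) || (y == x.+1) && (z == y.+1).

Lemma triples_star_consecutive n : 3 <= n ->
  triples star_consecutive n = 'C(n, 2) - 2.
Proof.
elim: n => [|[|[|n] IHn]] // _; case: n IHn => [|n] IHn.
  by rewrite !(triplesS, pairsS, triples0, pairs0, big_ord_recr, big_ord0).
rewrite triplesS IHn // pairsS.
rewrite (@eq_pairs _ (fun x y => x == 0)); last first.
  by move=> x y xy; rewrite /star_consecutive; lia.
rewrite (eq_bigr (fun x : 'I_n.+2 => (x == 0 :> nat) + (x == n.+1 :> nat))); last first.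
  by move=> x _; rewrite /star_consecutive; lia.
rewrite big_split /= !sum_eqn.
have -> : pairs (fun x _ => x == 0) n.+2 = n.+1.
  elim: n {IHn} => [|n IHn]; first by rewrite !(pairsS, pairs0, big_ord_recr, big_ord0).
  by rewrite pairsS IHn sum_eqn; lia.
by have : 2 <= 'C(n.+3, 2); rewrite ?(binS n.+3 1) ?bin1 ?(binS n.+2 1) ?bin1; lia.
Qed.

(** In a copy of [M2] each triple has only one pair not separated by the other triple, so neither is
    consecutive. In the example both would contain 0, but they are disjoint. *)
Lemma ex_cyc_M2 n : 7 <= n -> ex_cyc n M2 = 'C(n, 2) - 2.
Proof.
case: n => // n n7; apply: (@ex_cyc_eq _ _ _ _ star_consecutive).
- move=> H cghH nF; rewrite card_cgh //; apply: triples_M2_free => //.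
    exact: tri_cyclic.
  move=> a b c d e f abc cde ef; apply: contraNN nF => /andP[T1 T2].
  by apply: (@contains_pairI _ _ _ [:: a; b; c; d; e; f]) => //=; lia.
- apply/negP => /contains_pairP[f cycf]; rewrite !imset_set3 => -[T1 T2].
  have cyc i j k : i < j < k -> k < 6 ->
      cyc_lt (f (inord i)) (f (inord j)) (f (inord k)).
    by move=> ijk k6; apply: cycf; rewrite !inordK; lia.
  have := set3_cgh_of (cyc 0 1 3 isT isT) T1.
  have := set3_cgh_of (cyc 2 4 5 isT isT) T2.
  have := cyc 0 1 2 isT isT; have := cyc 0 2 3 isT isT.
  have := cyc 0 3 4 isT isT; have := cyc 0 4 5 isT isT.
  rewrite /cyc_lt /star_consecutive; move: (f _) (f _) (f _) (f _) (f _) (f _).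
  move=> x0 x1 x2 x3 x4 x5; lia.
- by apply: triples_star_consecutive; lia.
Qed.

Theorem theorem4 :
  [/\ forall n : nat, 3 <= n -> ex_cyc n M3 = 'C(n, 3) - 'C(n - 3, 3),
      forall n : nat, 7 <= n -> ex_cyc n M2 = 'C(n, 2) - 2
    & forall n : nat, 4 <= n -> ~~ odd n -> ex_cyc n S3 = (n * (n - 2)) %/ 2].
Proof.
by split=> n; [exact: ex_cyc_M3 | exact: ex_cyc_M2 | exact: ex_cyc_S3].
Qed.
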